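(* Let $n \geq 4$. Suppose that $G$ is a locally compact group acting continuously, $n$-properly and $n$-cocompactly on a compact, locally connected, perfect and metrizable space $M$. Then there is a set $P \subset M$ of cardinality at most $\lfloor \frac{n-1}{2} \rfloor$ such that $M \setminus P$ is not connected.
   Context: Locally compact groups are Hausdorff. A perfect space is a nonempty space without isolated points. $G$ acts continuously on $M$ if the action map $G\times M\to M$ is continuous. $M^{(n)}\subset M^n$ is the space of $n$-tuples of pairwise distinct points, with the topology induced by the product topology and the diagonal $G$-action. The action on $M$ is $n$-proper if for every compact $K\subset M^{(n)}$ the set $\{\gamma\in G\mid \gamma K\cap K\neq\emptyset\}$ has compact closure in $G$; it is $n$-cocompact if there is a compact $K\subset M^{(n)}$ with $M^{(n)}=GK$. *)

(* Defs.v *)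
From HB Require Import structures.
From mathcomp Require Import all_boot all_order all_algebra.
From mathcomp Require Import all_classical all_reals all_analysis.

Set Implicit Arguments.
Unset Strict Implicit.
Unset Printing Implicit Defensive.

Local Open Scope classical_set_scope.

HB.mixin Record isTopologicalGroup G of Topological G & Group G := {
  mulg_continuous : continuous (fun z : G * G => (z.1 * z.2)%g);
  invg_continuous : continuous (fun g : G => (g^-1)%g)
}.

#[short(type="topologicalGroupType")]
HB.structure Definition TopologicalGroup :=
  {G of Topological G & Group G & isTopologicalGroup G}.

Definition locally_compact_group (G : topologicalGroupType) : Prop :=
  hausdorff_space G /\ locally_compact [set: G].

Definition perfect_space (M : topologicalType) : Prop :=
  [set: M] !=set0 /\ perfect_set [set: M].

Definition locally_connected (M : topologicalType) : Prop :=
  forall (x : M) (U : set M), nbhs x U ->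
    exists V : set M, [/\ open V, V x, connected V & V `<=` U].

Definition metrizable (R : realType) (M : topologicalType) : Prop :=
  exists (X : metricType R) (f : M -> X) (f' : X -> M),
    [/\ cancel f f', cancel f' f, continuous f & continuous f'].

Definition continuous_action (G : topologicalGroupType) (M : topologicalType)
    (act : G -> M -> M) : Prop :=
  [/\ forall x, act 1%g x = x,
      forall g h x, act (g * h)%g x = act g (act h x) &
      continuous (fun z : G * M => act z.1 z.2)].

Definition distinct_tuples (M : topologicalType) (n : nat) :
    set {ptws 'I_n -> M} :=
  [set p | injective p].
Arguments distinct_tuples : clear implicits.

Section DiagonalAction.
Variables (G : topologicalGroupType) (M : topologicalType).
Variables (act : G -> M -> M) (n : nat).

Definition diag_act (g : G) (p : {ptws 'I_n -> M}) : {ptws 'I_n -> M} :=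
  fun i => act g (p i).

(* [subspace A] retopologizes the whole ambient type, the points outside [A]
   being isolated, hence the inclusion of [K] as a separate condition. *)
Definition compact_distinct_tuples (K : set {ptws 'I_n -> M}) : Prop :=
  K `<=` distinct_tuples M n /\
  compact (K : set (subspace (distinct_tuples M n))).

Definition n_proper : Prop :=
  forall K, compact_distinct_tuples K ->
    compact (closure [set g : G | (diag_act g @` K) `&` K !=set0]).

Definition n_cocompact : Prop :=
  exists2 K, compact_distinct_tuples K &
    distinct_tuples M n = \bigcup_(g in [set: G]) (diag_act g @` K).

End DiagonalAction.

(* Main.v *)
(** Suppose that no set of at most k = (n-1)/2 points disconnects M.  Along an
ultrafilter on G that does not converge, the graphs of the elements g
converge to a closed relation L on M.  By n-properness L contains no n pairs
with distinct first and distinct second coordinates, and since M is locally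
connected all rows and columns of L are connected, hence singletons or infinite.
As 2(k+1) >= n, L or its transpose has at most k infinite rows.  Off those
rows L is a continuous function with finitely many values on a connected
space, hence a constant b; the same argument for the columns other than b
gives a point a with L contained in {a} x M union M x {b}: G acts as a
convergence group.  Cocompactness contradicts this: bringing tuples
(y, x0, x1, x2, ...) back into a compact set of distinct tuples as y tends to
x0 gives an ultrafilter on G which cannot converge, as y and x0 stay apart,
and the images of x0, x1, x2 give three pairs in L with distinct
coordinates. *)

Require Import Defs.
From mathcomp Require Import all_boot all_order all_algebra.
From mathcomp Require Import all_classical all_reals all_analysis.
From mathcomp Require Import zify.

Set Implicit Arguments.
Unset Strict Implicit.
Unset Printing Implicit Defensive.

Local Open Scope classical_set_scope.

(** * Cardinality bounds by finite sequences *)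

Lemma card_set_seq_le (T : choiceType) (s : seq T) :
  ([set` s] #<= `I_(size s))%card.
Proof.
case: s => [|x s]; first by rewrite set_nil card_ge0.
have -> : [set` x :: s] = nth x (x :: s) @` `I_(size (x :: s)).
  apply/seteqP; split=> [y /= ys|y /= [i ii <-]]; last exact: mem_nth.
  by exists (index y (x :: s)); rewrite ?index_mem ?nth_index.
exact: card_image_le.
Qed.

(** A sequence of at most [k] points of [A] that could not be extended within [A] would list all of
    [A]. *)
Lemma uniq_seq_of_card (T : choiceType) (A : set T) (k : nat) :
  ~ (A #<= `I_k)%card ->
  exists s : seq T, [/\ uniq s, size s = k.+1 & [set` s] `<=` A].
Proof.
move=> Ak; have : (k.+1 <= k.+1)%N by [].
elim: {-2}k.+1 => [_|j IH jk]; first by exists [::]; split => // x.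
have [s [us sj sA]] := IH (ltnW jk).
have [[x Ax xs]|H] := pselect (exists2 x, A x & x \notin s).
  exists (x :: s); split=> /=; rewrite ?xs ?sj //.
  by move=> y /=; rewrite inE => /predU1P[->//|/sA].
exfalso; apply: Ak; apply: card_le_trans (subset_card_le _) _; last first.
  apply: card_le_trans (card_set_seq_le s) _.
  by rewrite card_le_II sj.
by move=> x Ax /=; apply: contrapT => /negP xs; apply: H; exists x.
Qed.

(** * Matchings in a relation *)

Section Matching.

Definition matching (T U : eqType) (L : T -> U -> Prop) (s : seq (T * U)) :=
  [/\ uniq (unzip1 s), uniq (unzip2 s) & forall p, p \in s -> L p.1 p.2].

Definition transpose_rel (T U : Type) (L : T -> U -> Prop) : U -> T -> Prop :=
  fun y x => L x y.

Lemma matching_transpose (T U : eqType) (L : T -> U -> Prop) s :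
  matching (transpose_rel L) s -> matching L [seq (p.2, p.1) | p <- s].
Proof.
move=> [u1 u2 H]; split; rewrite /unzip1 /unzip2 -?map_comp //.
by move=> p /mapP[q /H ? ->].
Qed.

(** Greedy choice: each row has an entry outside [t] and outside the columns already used. *)
Lemma matching_of_rows (T U : eqType) (L : T -> U -> Prop) (s : seq T)
    (t : seq U) :
  uniq s ->
  (forall x, x \in s -> forall r : seq U, exists2 y, L x y & y \notin r) ->
  exists2 m, matching L m & unzip1 m = s /\ all [predC t] (unzip2 m).
Proof.
elim: s => [_ _|x s IH /= /andP[xs us] H]; first by exists [::].
have [|m [u1 u2 Lm] [m1 m2]] := IH us.
  by move=> y ys; apply: H; rewrite inE ys orbT.
have [|y Lxy] := H x _ (t ++ unzip2 m); first by rewrite mem_head.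
rewrite mem_cat negb_or => /andP[yt ym].
exists ((x, y) :: m); last by split; rewrite /= ?m1 ?yt.
split => /=; rewrite ?ym ?u2 // ?m1 ?xs //.
by move=> p; rewrite inE => /predU1P[->|/Lm].
Qed.

(** When rows are connected in a Hausdorff space, these are exactly the infinite rows. *)
Definition multivalued (T U : Type) (L : T -> U -> Prop) : set T :=
  [set x | exists y z, [/\ L x y, L x z & y <> z]].

(* Rows are matched to columns outside [t], and columns in [t] to rows outside
   [s], so the two matchings can be concatenated. *)
Lemma matching_of_rows_cols (T U : choiceType) (L : T -> U -> Prop) (k : nat) :
  (forall x, multivalued L x ->
    forall r : seq U, exists2 y, L x y & y \notin r) ->
  (forall y, multivalued (transpose_rel L) y ->
    forall r : seq T, exists2 x, L x y & x \notin r) ->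
  ~ (multivalued L #<= `I_k)%card ->
  ~ (multivalued (transpose_rel L) #<= `I_k)%card ->
  exists2 m, matching L m & size m = (k.+1 + k.+1)%N.
Proof.
move=> rows cols /uniq_seq_of_card[s [us ss sL]] /uniq_seq_of_card[t [ut st tL]].
have [|m [m1 m2 mL] [ms mt]] := @matching_of_rows _ _ L s t us.
  by move=> x /sL; exact: rows.
have [|m' mL' [mt' ms']] := @matching_of_rows _ _ (transpose_rel L) t s ut.
  by move=> y /tL; exact: cols.
have [m1' m2' {}mL'] := matching_transpose mL'.
set m'' := map _ _ in m1' m2' mL'.
have E1 : unzip1 m'' = unzip2 m' by rewrite /unzip1 -map_comp.
have E2 : unzip2 m'' = unzip1 m' by rewrite /unzip2 -map_comp.
exists (m ++ m''); last first.
  by rewrite size_cat size_map -{1}ss -st -ms -mt' !size_map.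
split.
- rewrite /unzip1 map_cat -/(unzip1 m) -/(unzip1 m'') cat_uniq m1 m1' andbT /=.
  by rewrite -all_predC E1 ms.
- rewrite /unzip2 map_cat -/(unzip2 m) -/(unzip2 m'') cat_uniq m2 m2' andbT /=.
  rewrite E2 mt' -all_predC; apply/allP => y yt /=.
  by apply/negP => /(allP mt) /=; rewrite yt.
- by move=> p; rewrite mem_cat => /orP[/mL|/mL'].
Qed.

End Matching.

(** * Relations with connected rows and columns *)

Section ConnectedRelation.
Variable M : topologicalType.
Hypothesis hM : hausdorff_space M.

Lemma closed_set_seq (s : seq M) : closed [set` s].
Proof.
have /accessible_finite_set_closed := hausdorff_accessible hM.
by apply; apply/finite_seqP; exists s.
Qed.

(** Finite sets are closed in a Hausdorff space, so [[set x]] is clopen in [C]. *)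
Lemma connected_subset_seq (C : set M) (s : seq M) (x y : M) :
  connected C -> C `<=` [set` s] -> C x -> C y -> x = y.
Proof.
move=> cC Cs Cx Cy; suff E : [set x] = C by move: Cy; rewrite -E.
apply: cC; first by exists x.
- exists (~` [set` [seq z <- s | z != x]]).
    exact/closed_openC/closed_set_seq.
  apply/seteqP; split=> [z ->|z [Cz]] /=.
    by split => //; rewrite mem_filter eqxx.
  rewrite mem_filter /= => /negP; rewrite negb_and negbK => /orP[/eqP//|].
  by rewrite (Cs _ Cz).
- exists [set x]; first by rewrite -set_cons1; exact: closed_set_seq.
  by apply/seteqP; split=> [z ->|z []].
Qed.

(** Off [P] a row is connected and lies in [s], so it is a point. The finitely many fibres are
    closed and disjoint off [P], hence clopen in its connected complement. *)
Lemma constant_off (L : M -> M -> Prop) (P : set M) (s : seq M) (z : M) :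
  (forall x, connected (L x)) -> (forall y, closed (transpose_rel L y)) ->
  (forall x, exists y, L x y) ->
  connected (~` P) -> (forall x y, ~ P x -> L x y -> y \in s) ->
  exists b, forall x y, L x y -> P x \/ y = b.
Proof.
move=> cL clL neL cP Ps.
have [[x0 Px0]|H] := pselect (exists x, ~ P x); last first.
  (* If [P] is the whole space, the arbitrary point [z] serves as [b]. *)
  by exists z => x y _; left; apply: contrapT => Px; apply: H; exists x.
have uL x y y' : ~ P x -> L x y -> L x y' -> y = y'.
  move=> Px; apply: (@connected_subset_seq _ s) => // t; exact: Ps.
have [b Lb] := neL x0; exists b => x y Lxy.
have [Px|Px] := pselect (P x); [by left|right].
suff E : ~` P `&` transpose_rel L b = ~` P.
  by have : (~` P) x by []; rewrite -E => -[_ Lxb]; exact: uL Lxy Lxb.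
apply: cP; [by exists x0| |by exists (transpose_rel L b)].
exists (~` \bigcup_(c in [set` [seq c <- s | c != b]]) transpose_rel L c).
  apply: closed_openC; apply: closed_bigcup => //.
  by apply/finite_seqP; eexists.
apply/seteqP; split=> [t [Pt Lt]|t [Pt Lt]]; split => //.
  move=> [c /=]; rewrite mem_filter /= => /andP[/eqP cb _] Lc.
  by apply: cb; exact: uL Lc Lt.
have [c Lc] := neL t.
have [cb|cb] := eqVneq c b; first by rewrite -cb.
exfalso; apply: Lt; exists c => //=; rewrite mem_filter /= cb.
exact: Ps Lc.
Qed.

Lemma two_point_relation (L : M -> M -> Prop) (n k : nat) (z : M) :
  (0 < k)%N ->
  (forall P : set M, (P #<= `I_k)%card -> connected (~` P)) ->
  (forall x, connected (L x)) -> (forall y, connected (transpose_rel L y)) ->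
  (forall x, closed (L x)) -> (forall y, closed (transpose_rel L y)) ->
  (forall x, exists y, L x y) -> (forall y, exists x, L x y) ->
  (forall m, matching L m -> size m <> n) ->
  (multivalued L #<= `I_k)%card ->
  exists a b, forall x y, L x y -> x = a \/ y = b.
Proof.
move=> k0 cM cL cL' clL clL' nL nL' mL Lk; set S := multivalued L in Lk.
have uS x y y' : ~ S x -> L x y -> L x y' -> y = y'.
  by move=> Sx Ly Ly'; apply: contrapT => yy'; apply: Sx; exists y, y'.
(* Distinct values off [S] come from distinct rows, so [n] of them would form a matching. *)
have [r hr] : exists r : seq M, forall x y, ~ S x -> L x y -> y \in r.
  set Y := [set y | exists2 x, ~ S x & L x y].
  have : (Y #<= `I_n)%card.
    apply: contrapT => /uniq_seq_of_card[r [ur sr rY]].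
    have [g hg] : exists g : M -> M,
        forall y, y \in r -> ~ S (g y) /\ L (g y) y.
      suff /choice[g] : forall y, exists x, y \in r -> ~ S x /\ L x y.
        by exists g.
      move=> y; have [/rY[x]|] := boolP (y \in r); last by exists z.
      by exists x.
    (* [r] has [n.+1] terms, while [mL] excludes the size [n] exactly. *)
    apply: (mL [seq (g y, y) | y <- take n r]); last first.
      by rewrite size_map size_take sr ltnSn.
    have ut := take_uniq n ur.
    split; rewrite /unzip1 /unzip2 -?map_comp /= ?map_id //.
      rewrite map_inj_in_uniq // => y y' /mem_take/hg[Sy Ly].
      move=> /mem_take/hg[_ Ly'] /= E.
      by apply: uS Sy Ly _; rewrite E.
    by move=> p /mapP[y /mem_take/hg[_ ?] ->].
  move=> Yn; have /finite_seqP[r rE] : finite_set Y.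
    by apply/finite_set_leP; exists n.
  by exists r => x y Sx Lxy; have : Y y; [exists x|rewrite rE].
have [b hb] := constant_off z cL clL' nL (cM _ Lk) hr.
have /finite_seqP[q qE] : finite_set S by apply/finite_set_leP; exists k.
(* As [k] is positive, removing [b] does not disconnect. Columns other than [b] lie in the finite
   set [S], so [constant_off] applies to the transpose. *)
have cb : connected (~` [set b]).
  apply: cM; rewrite -set_cons1; apply: card_le_trans (card_set_seq_le _) _.
  by rewrite card_le_II.
have [|a ha] := @constant_off (transpose_rel L) [set b] q z cL' clL nL' cb.
  move=> y x yb Lxy; have [Sx|//] := hb _ _ Lxy.
  by move: Sx; rewrite qE.
exists a, b => x y Lxy; have [->|->] := ha _ _ Lxy; by [right|left].
Qed.

(** If [L] and its transpose both had more than [k] multivalued rows, [k.+1] of each would give a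
    matching of size at least [n], which can be cut down to [n]. *)
Lemma two_point_relation_of_matching (L : M -> M -> Prop) (n k : nat) (z : M) :
  (0 < k)%N -> (n <= k.+1 + k.+1)%N ->
  (forall P : set M, (P #<= `I_k)%card -> connected (~` P)) ->
  (forall x, connected (L x)) -> (forall y, connected (transpose_rel L y)) ->
  (forall x, closed (L x)) -> (forall y, closed (transpose_rel L y)) ->
  (forall x, exists y, L x y) -> (forall y, exists x, L x y) ->
  (forall m, matching L m -> size m <> n) ->
  exists a b, forall x y, L x y -> x = a \/ y = b.
Proof.
move=> k0 nk cM cL cL' clL clL' nL nL' mL.
have [Lk|Lk] := pselect (multivalued L #<= `I_k)%card.
  by have := two_point_relation z k0 cM cL cL' clL clL' nL nL' mL Lk.
have [Lk'|Lk'] := pselect (multivalued (transpose_rel L) #<= `I_k)%card.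
  have mL' m : matching (transpose_rel L) m -> size m <> n.
    by move=> /matching_transpose/mL; rewrite size_map; exact.
  have [a [b ab]] := two_point_relation z k0 cM cL' cL clL' clL nL' nL mL' Lk'.
  exists b, a => x y /ab; tauto.
have inf (L' : M -> M -> Prop) : (forall x, connected (L' x)) ->
    forall x, multivalued L' x ->
    forall r : seq M, exists2 y, L' x y & y \notin r.
  move=> cL0 x [y [y' [Ly Ly' yy']]] r; apply: contrapT => H; apply: yy'.
  apply: (@connected_subset_seq _ r _ _ (cL0 x)) => // t Lt /=.
  by apply: contrapT => /negP tr; apply: H; exists t.
have [m [m1 m2 Lm] sm] := matching_of_rows_cols (inf _ cL) (inf _ cL') Lk Lk'.
exfalso; apply: (mL (take n m)); last by rewrite size_takel ?sm.
split; rewrite /unzip1 /unzip2 ?map_take ?take_uniq //.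
by move=> p /mem_take/Lm.
Qed.

End ConnectedRelation.

(** * Limits of graphs along an ultrafilter *)

Section LimitRelation.
Variables (G : topologicalGroupType) (M : topologicalType).
Variable act : G -> M -> M.
Hypotheses (hM : hausdorff_space M) (cM : compact [set: M]).
Hypothesis actM : continuous_action act.

(** The lower limit of the graphs of [act g] along [U]; for an ultrafilter it is also the upper
    limit. *)
Definition limit_rel (U : set_system G) (x y : M) : Prop :=
  forall V W : set M, nbhs x V -> nbhs y W ->
    U [set g | exists2 z, V z & W (act g z)].

Lemma act_continuous (g : G) : continuous (act g).
Proof.
have [_ _ ca] := actM => x.
apply: (@continuous_comp _ _ _ (fun x => (g, x)) (fun z : G * M => act z.1 z.2)).
  by apply: cvg_pair; [exact: cvg_cst|exact: cvg_id].
exact: ca.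
Qed.

Lemma act_invK (g : G) (x : M) : act (g^-1)%g (act g x) = x.
Proof. by have [a1 aM _] := actM; rewrite -aM mulVg a1. Qed.

(** Exchanging coordinates turns the graph of [g] into that of its inverse, so results on rows
    transfer to columns. *)
Lemma transpose_limit_rel (U : set_system G) : Filter U ->
  transpose_rel (limit_rel U) = limit_rel ((fun g => (g^-1)%g) @ U).
Proof.
move=> FU; apply/funext => y; apply/funext => x; apply/propext.
split=> H V W nV nW; apply: (@filterS _ U _ _ _ _ (H W V nW nV));
  move=> g /= [z Wz Vz].
  by exists (act g z) => //; rewrite act_invK.
by exists (act (g^-1)%g z) => //; rewrite -{1}(invgK g) act_invK.
Qed.

Lemma closed_limit_rel (U : set_system G) (x : M) : closed (limit_rel U x).
Proof.
move=> y cy V W nV nW.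
have [y' [Ly' Wy']] := cy _ (nbhs_interior nW).
exact: Ly'.
Qed.

(* A cluster point in [C] of the images [act g z], for [g] along [U] and [z]
   tending to [x], is a limit along [U] because [U] is an ultrafilter. *)
Lemma limit_rel_meets (U : set_system G) (x : M) (C : set M) :
  UltraFilter U -> closed C ->
  (forall V, nbhs x V -> U [set g | exists2 z, V z & C (act g z)]) ->
  exists2 y, C y & limit_rel U x y.
Proof.
move=> UU clC UC.
pose F : set_system M := [set T | exists V A, [/\ nbhs x V, U A &
  forall g z, A g -> V z -> C (act g z) -> T (act g z)]].
have PF : ProperFilter F.
  split.
    move=> [V [A [nV UA H]]].
    have [g [[z Vz Cz] Ag]] := filter_ex (filterI (UC _ nV) UA).
    exact: H Ag Vz Cz.
  split.
  - by exists setT, setT; split => //; exact: filterT.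
  - move=> S T [V [A [nV UA H]]] [V' [A' [nV' UA' H']]].
    exists (V `&` V'), (A `&` A'); split; [exact: filterI..|].
    by move=> g z [Ag A'g] [Vz V'z] Cz; split; [exact: H|exact: H'].
  - move=> S T ST [V [A [nV UA H]]]; exists V, A; split=> // g z Ag Vz Cz.
    exact/ST/H.
have cC : compact C by exact: subclosed_compact clC cM _.
have [|y [Cy cy]] := cC F PF.
  by exists setT, setT; split => //; exact: filterT.
exists y => // V W nV nW.
have [//|UN] := in_ultra_setVsetC [set g | exists2 z, V z & W (act g z)] UU.
(* Otherwise, for [U]-most [g], no point of [V] is sent into [W]; this gives a member of [F]
   disjoint from [W]. *)
exfalso; have [||w [[g [z [Vz H <-]]] Ww]] :=
  cy [set w | exists g z,
    [/\ V z, ~ (exists2 z, V z & W (act g z)) & act g z = w]] W.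
- exists V, (~` [set g | exists2 z, V z & W (act g z)]); split=> //.
  by move=> g z Ag Vz Cz; exists g, z.
- exact: nW.
- by apply: H; exists z.
Qed.

Lemma limit_rel_nonempty (U : set_system G) (x : M) :
  UltraFilter U -> exists y, limit_rel U x y.
Proof.
move=> UU; have [||y _ Ly] := @limit_rel_meets U x setT UU.
- exact: closedT.
- move=> V /nbhs_singleton Vx; apply: filterS filterT => g _.
  by exists x.
- by exists y.
Qed.

(** If [D] missed the boundary of [O], the interior and the closure of [O] would have the same trace
    on [D], which would be clopen. *)
Lemma connected_meets_boundary (D O : set M) : connected D ->
  D `&` O° !=set0 -> D `&` ~` closure O !=set0 ->
  D `&` (closure O `\` O°) !=set0.
Proof.
move=> cD DO [q [Dq nOq]]; apply: contrapT => H; apply: nOq.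
apply: subset_closure; apply: interior_subset.
suff E : D `&` O° = D by move: Dq; rewrite -{1}E => -[].
apply: cD => //; first by exists O° => //; exact: open_interior.
exists (closure O); first exact: closed_closure.
apply/seteqP; split=> z [Dz Oz]; split=> //.
  by apply: subset_closure; exact: interior_subset.
by apply: contrapT => NOz; apply: H; exists z.
Qed.

(* If [D] separated the row of [x], the image under [g] of a small connected
   neighborhood of [x] would cross the boundary of [D] for [U]-most [g], and so
   would the row. *)
Lemma connected_limit_rel (U : set_system G) (x : M) :
  UltraFilter U -> locally_connected M -> connected (limit_rel U x).
Proof.
move=> UU lcM; apply/connectedP => E [E0 EU sE].
have [sE1 sE2] := sE.
have EL b : E b `<=` limit_rel U x.
  by rewrite EU; case: b => y Ey; [right|left].
have clE : closed (E false).
  move=> y Ey; have : limit_rel U x y.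
    by apply: closed_limit_rel; move: Ey; apply: closureS; exact: EL.
  rewrite EU => -[//|E1y].
  by have : (closure (E false) `&` E true) y by []; rewrite sE1.
have nE1 : set_nbhs (E false) (~` closure (E true)).
  apply/set_nbhsP; exists (~` closure (E true)); split=> //.
    exact/closed_openC/closed_closure.
  by apply/disjoints_subset.
have [D nD DN] := compact_normal hM cM clE nE1.
have E0D : E false `<=` D° by move=> y Ey; exact: nD.
have E1D : E true `<=` ~` closure D.
  by move=> y Ey /DN; apply; exact: subset_closure.
(* The boundary of [D] is disjoint from both parts of the row, so a point of the row on it is a
   contradiction. *)
have [|V nV|y [cDy Dy]] := @limit_rel_meets U x (closure D `\` D°) UU.
- apply: closedI; first exact: closed_closure.
  exact/open_closedC/open_interior.
- have [V' [oV' V'x cV' V'V]] := lcM x V nV.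
  have nV' : nbhs x V' by exact: open_nbhs_nbhs.
  have [[e Ee] [e' Ee']] := (E0 false, E0 true).
  have nDe : nbhs e D°.
    apply: open_nbhs_nbhs; split; [exact: open_interior|exact: E0D].
  have nDe' : nbhs e' (~` closure D).
    apply: open_nbhs_nbhs; split; last exact: E1D.
    exact/closed_openC/closed_closure.
  apply: filterS (filterI (EL _ _ Ee _ _ nV' nDe) (EL _ _ Ee' _ _ nV' nDe')).
  move=> g /= [[z Vz Dz] [z' Vz' Dz']].
  have [|||w [[t Vt <-] tD]] := @connected_meets_boundary (act g @` V') D.
  + apply: connected_continuous_connected => //.
    by apply: continuous_subspaceT; exact: act_continuous.
  + by exists (act g z); split => //; exists z.
  + by exists (act g z'); split => //; exists z'.
  + by exists t => //; exact: V'V.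
- by rewrite EU => -[/E0D//|/E1D]; apply.
Qed.

(** By regularity two distinct points have disjoint closed neighborhoods; [V i] is a finite
    intersection of such. *)
Lemma disjoint_closed_nbhs (I : finType) (x : I -> M) : injective x ->
  exists V : I -> set M,
    [/\ forall i, nbhs (x i) (V i), forall i, closed (V i) &
    forall i j, V i `&` V j !=set0 -> i = j].
Proof.
move=> inj_x.
have sep (p q : M) : exists EF : set M * set M, p <> q ->
    [/\ nbhs p EF.1, nbhs q EF.2, closed EF.1, closed EF.2 &
      EF.1 `&` EF.2 = set0].
  have [->|pq] := eqVneq p q; first by exists (set0, set0).
  have := hM; rewrite open_hausdorff => /(_ p q pq).
  move=> [[A B] /= [/set_mem Ap /set_mem Bq] [oA oB /eqP AB]].
  have [A' nA' A'A] : exists2 A', nbhs p A' & closure A' `<=` A.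
    by apply: (compact_regular hM cM filterT); exact: open_nbhs_nbhs.
  have [B' nB' B'B] : exists2 B', nbhs q B' & closure B' `<=` B.
    by apply: (compact_regular hM cM filterT); exact: open_nbhs_nbhs.
  exists (closure A', closure B') => _; split.
  - by apply: filterS nA'; exact: subset_closure.
  - by apply: filterS nB'; exact: subset_closure.
  - exact: closed_closure.
  - exact: closed_closure.
  - by apply/seteqP; split=> // t [/A'A At /B'B Bt]; rewrite -AB.
have /choice[EF HEF] : forall pq : M * M, exists EF : set M * set M,
    pq.1 <> pq.2 -> [/\ nbhs pq.1 EF.1, nbhs pq.2 EF.2, closed EF.1,
      closed EF.2 & EF.1 `&` EF.2 = set0].
  by move=> [p q]; exact: sep.
have neq i j : i != j -> x i <> x j by move=> ij /inj_x/eqP; apply/negP.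
(* The chosen [EF] need not be symmetric, hence the two orders of each pair. *)
exists (fun i => [set y | forall j, j != i ->
  (EF (x i, x j)).1 y /\ (EF (x j, x i)).2 y]); split.
- move=> i; apply: filter_forall => j.
  have [->|ji] := eqVneq j i; first by apply: filterS filterT.
  have [n1 _ _ _ _] := HEF (x i, x j) (nesym (neq _ _ ji)).
  have [_ n2 _ _ _] := HEF (x j, x i) (neq _ _ ji).
  by apply: filterS (filterI n1 n2).
- move=> i y cy j ji.
  have [_ _ c1 _ _] := HEF (x i, x j) (nesym (neq _ _ ji)).
  have [_ _ _ c2 _] := HEF (x j, x i) (neq _ _ ji).
  split; [apply: c1|apply: c2]; apply: closureS cy => t /(_ _ ji)[] //.
- move=> i j [y [Vi Vj]]; apply: contrapT => /eqP ij.
  have [_ _ _ _ E] := HEF (x i, x j) (neq _ _ ij).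
  have [Ey _] := Vi j (negbT (introF eqP (nesym (elimN eqP ij)))).
  have [_ Fy] := Vj i ij.
  by have : set0 y by rewrite -E; split.
Qed.

(** Disjointness of the factors makes every tuple of the box injective, and Tychonoff makes the box
    compact. *)
Lemma compact_box (n : nat) (x : 'I_n -> M) : injective x ->
  exists V : 'I_n -> set M, (forall i, nbhs (x i) (V i)) /\
    compact_distinct_tuples [set p : {ptws 'I_n -> M} | forall i, V i (p i)].
Proof.
move=> /disjoint_closed_nbhs[V [nV cV dV]]; exists V; split => //.
set K := [set p | _].
have KD : K `<=` distinct_tuples M n.
  move=> p Kp i j pij; apply: dV; exists (p i); split; first exact: Kp.
  by rewrite pij; exact: Kp.
split=> //.
suff : compact
    (K `&` distinct_tuples M n : set (subspace (distinct_tuples M n))).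
  by have /setIidPl -> := KD.
apply/compact_subspaceIP; have /setIidPl -> := KD.
apply: (@tychonoff 'I_n (fun=> M) V) => i.
exact: subclosed_compact (cV i) cM _.
Qed.

Lemma compact_distinct_tuplesU (n : nat) (K K' : set {ptws 'I_n -> M}) :
  compact_distinct_tuples K -> compact_distinct_tuples K' ->
  compact_distinct_tuples (K `|` K').
Proof.
move=> [KD cK] [KD' cK']; split; first by rewrite subUset.
exact: compactU.
Qed.

(** A matching of size [n] gives compact boxes around its two tuples. [U]-most [g] send some tuple
    of the first box into the second, so properness for their union puts a set with compact closure
    in [U], forcing convergence. *)
Lemma limit_rel_no_matching (U : set_system G) (n : nat) :
  UltraFilter U -> n_proper act n -> ~ (exists g : G, U --> g) ->
  forall m, matching (limit_rel U) m -> size m <> n.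
Proof.
move=> UU np Ucvg m [u1 u2 Lm] sm; apply: Ucvg.
have mtuple : size m == n by apply/eqP.
pose t : n.-tuple (M * M) := Tuple mtuple.
have inj1 : injective (fun i => (tnth t i).1).
  have /tuple_uniqP inj : uniq [tuple of map fst t] by [].
  by move=> i j E; apply: inj; rewrite !tnth_map.
have inj2 : injective (fun i => (tnth t i).2).
  have /tuple_uniqP inj : uniq [tuple of map snd t] by [].
  by move=> i j E; apply: inj; rewrite !tnth_map.
have [V [nV cV]] := compact_box inj1.
have [W [nW cW]] := compact_box inj2.
have cE := np _ (compact_distinct_tuplesU cV cW).
set E := [set g | _] in cE.
have UE : U E.
  have : U [set g | forall i, exists2 z, V i z & W i (act g z)].
    apply: filter_forall => i; apply: (Lm (tnth t i)) => //.
    exact: (mem_tnth i t).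
  apply: filterS => g H.
  have /choice[p Hp] : forall i, exists z, V i z /\ W i (act g z).
    by move=> i; have [z] := H i; exists z.
  exists (diag_act act g p); split.
    by exists p => //; left => i; have [] := Hp i.
  by right => i; have [] := Hp i.
move: cE; rewrite compact_ultra => /(_ U UU)[].
  by apply: filterS UE; exact: subset_closure.
by move=> g [_ Ug]; exists g.
Qed.

End LimitRelation.

(** * Perfect spaces and the contradiction with cocompactness *)

Lemma ultra_fmap (S T : Type) (f : S -> T) (F : set_system S) :
  UltraFilter F -> UltraFilter (f @ F).
Proof.
move=> UF; split; first exact: fmap_proper_filter.
move=> H PH FH; apply/seteqP; split=> // A HA.
have [//|FA] := in_ultra_setVsetC (f @^-1` A) UF.
by have /filter_ex[x []] : H (A `&` ~` A) by apply: filterI => //; exact: FH.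
Qed.

Lemma hausdorff_metrizable (R : realType) (M : topologicalType) :
  metrizable R M -> hausdorff_space M.
Proof.
move=> [X [f [f' [ff' _ cf _]]]] p q pq; apply: (can_inj ff').
apply: metric_hausdorff => A B nA nB.
by have [x [Ax Bx]] := pq _ _ (cf _ _ nA) (cf _ _ nB); exists (f x).
Qed.

Lemma proper_dnbhs (M : topologicalType) (x : M) :
  limit_point [set: M] x -> ProperFilter x^'.
Proof.
by move=> lx; split; [move=> /lx[y [yx _ /(_ yx)]]|exact: dnbhs_filter].
Qed.

Lemma perfect_uniq_seq (M : topologicalType) (x : M) (k : nat) :
  hausdorff_space M -> limit_point [set: M] x ->
  exists2 t : seq M, uniq (x :: t) & size t = k.
Proof.
move=> hM lx; elim: k => [|k [t /= /andP[xt ut] tk]]; first by exists [::].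
have [|y [yx _ /= /negP yt]] := lx (~` [set` t]).
  apply: open_nbhs_nbhs; split; first exact/closed_openC/closed_set_seq.
  exact/negP.
by exists (y :: t); rewrite /= ?tk // inE eq_sym negb_or yx xt yt ut.
Qed.

Theorem theoremE (R : realType) (n : nat) (G : topologicalGroupType)
    (M : topologicalType) (act : G -> M -> M) :
  (4 <= n)%N ->
  locally_compact_group G ->
  compact [set: M] -> locally_connected M -> perfect_space M ->
  metrizable R M ->
  continuous_action act -> n_proper act n -> n_cocompact act n ->
  exists P : set M,
    (P #<= `I_((n - 1) %/ 2))%card /\ ~ connected (~` P).
Proof.
move=> n4 _ cM lcM [[x0 _] [_ lpM]] /hausdorff_metrizable hM actM np.
move=> [K [KD cK] cover].
apply: contrapT => noP.
have {noP} cP (P : set M) : (P #<= `I_((n - 1) %/ 2))%card -> connected (~` P).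
  by move=> Pk; apply: contrapT => nc; apply: noP; exists P.
have lx0 : limit_point [set: M] x0 by rewrite lpM.
case: n n4 np K KD cK cover cP => [//|[//|[//|[//|n]]]] _ np K KD cK cover cP.
have [[//|x1 [//|x2 t]] ut [tn]] := perfect_uniq_seq n.+2 hM lx0.
(* The entries [y] and [x0] merge as [y] tends to [x0]; the others stay fixed. *)
pose p (y : M) : {ptws 'I_n.+4 -> M} := fun i => nth y [:: y, x0, x1, x2 & t] i.
have Dp y : y \notin [:: x0, x1, x2 & t] -> distinct_tuples M n.+4 (p y).
  move=> yt i j pij; apply: val_inj => /=.
  apply/eqP; rewrite -(@nth_uniq _ y [:: y, x0, x1, x2 & t]) /= ?tn //.
    exact/eqP.
  by rewrite yt.
have [h hK] : exists h : M -> G, forall y, y \notin [:: x0, x1, x2 & t] ->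
    K (diag_act act (h y) (p y)).
  suff /choice[h] : forall y, exists g : G, y \notin [:: x0, x1, x2 & t] ->
    K (diag_act act g (p y)) by exists h.
  move=> y; have [yt|yt] := boolP (y \in [:: x0, x1, x2 & t]).
    (* Default value where [p y] has a repeated entry. *)
    by exists 1%g.
  have := Dp y yt; rewrite cover => -[g _ [q Kq qp]].
  exists (g^-1)%g => _; rewrite -qp.
  suff -> : diag_act act (g^-1)%g (diag_act act g q) = q by [].
  by apply/funext => i; rewrite /diag_act (act_invK actM).
have PF := proper_dnbhs lx0.
have [F [UF x0F]] := ultraFilterLemma PF.
have Fx0 : F --> x0 by move=> A nA; apply: x0F; exact: nbhs_dnbhs.
have Ft : F [set y | y \notin [:: x0, x1, x2 & t]].
  have H1 : F [set y | y != x0] by apply: x0F; exact: nbhs_dnbhs_neq.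
  have H2 : F (~` [set` [:: x1, x2 & t]]).
    apply: Fx0; apply: open_nbhs_nbhs; split.
      exact/closed_openC/closed_set_seq.
    by move: ut => /= /andP[/negP].
  apply: filterS (filterI H1 H2) => y [/= yx /negP yt].
  by rewrite inE negb_or yx.
have UQ := ultra_fmap (fun y => diag_act act (h y) (p y)) UF.
(* Compactness of [K] gives a limit [q] of the returned tuples, still with distinct entries. *)
have [q [Kq Qq]] : K `&`
    [set q | (fun y => diag_act act (h y) (p y)) @ F --> q] !=set0.
  have : compact (K `&` distinct_tuples M n.+4 : set {ptws 'I_n.+4 -> M}).
    by apply/compact_subspaceIP; have /setIidPl -> := KD.
  have /setIidPl -> := KD; rewrite compact_ultra; apply => //.
  by apply: (@filterS _ F _ _ _ _ Ft) => y; exact: hK.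
have qi i : (fun y => act (h y) (p y i)) @ F --> q i.
  exact: (@cvg_comp _ _ _ _ (fun r : {ptws 'I_n.+4 -> M} => r i) _ _ _ Qq
    (@proj_continuous _ (fun=> M) i q)).
have injq : injective q by exact: KD.
have UU := ultra_fmap h UF.
have Lq i x : (forall y, p y i = x) -> limit_rel act (h @ F) x (q i).
  move=> px V W /nbhs_singleton Vx nW.
  apply: (@filterS _ F _ _ _ _ (qi i _ nW)) => y /= Wy.
  by exists x => //; rewrite -(px y).
pose i1 : 'I_n.+4 := Ordinal (isT : (1 < n.+4)%N).
(* If [h] converged to [g] along [F], entries 0 and 1 of [q] would both equal [act g x0]. *)
have [[g Ug]|Ucvg] := pselect (exists g : G, h @ F --> g).
  have [_ _ ca] := actM.
  have actF (f : M -> M) :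
      f @ F --> x0 -> (fun y => act (h y) (f y)) @ F --> act g x0.
    move=> fF; apply: (@cvg_comp _ _ _ (fun y => (h y, f y))
      (fun z : G * M => act z.1 z.2) F (nbhs (g, x0))).
      exact: cvg_pair Ug fF.
    exact: (ca (g, x0)).
  have c0 := actF id Fx0.
  have c1 : (fun y => act (h y) x0) @ F --> act g x0.
    by apply: (actF (fun=> x0)); exact: cvg_cst.
  pose i0 : 'I_n.+4 := Ordinal (isT : (0 < n.+4)%N).
  have q0 : q i0 = act g x0 by exact: (cvg_unique hM (qi i0) c0).
  have q1 : q i1 = act g x0 by exact: (cvg_unique hM (qi i1) c1).
  by have /injq : q i0 = q i1 by rewrite q0 q1.
pose i2 : 'I_n.+4 := Ordinal (isT : (2 < n.+4)%N).
pose i3 : 'I_n.+4 := Ordinal (isT : (3 < n.+4)%N).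
have L1 := Lq i1 x0 (fun=> erefl).
have L2 := Lq i2 x1 (fun=> erefl).
have L3 := Lq i3 x2 (fun=> erefl).
set U := h @ F in UU Ucvg L1 L2 L3.
have tU : transpose_rel (limit_rel act U) = limit_rel act _ :=
  transpose_limit_rel actM _.
have UU' := ultra_fmap (fun g : G => (g^-1)%g) UU.
have [||||||||a [b ab]] := @two_point_relation_of_matching M hM (limit_rel act U)
    n.+4 ((n.+4 - 1) %/ 2) x0 _ _ cP _ _ _ _ _ _
    (limit_rel_no_matching hM cM UU np Ucvg).
- by lia.
- by lia.
- by move=> x; exact: connected_limit_rel.
- by move=> y; rewrite tU; exact: connected_limit_rel.
- by move=> x; exact: closed_limit_rel.
- by move=> y; rewrite tU; exact: closed_limit_rel.
- by move=> x; exact: (limit_rel_nonempty act cM x UU).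
- by move=> y; have := limit_rel_nonempty act cM y UU'; rewrite -tU.
have q12 : q i1 <> q i2 by move=> /injq.
have q13 : q i1 <> q i3 by move=> /injq.
have q23 : q i2 <> q i3 by move=> /injq.
move: ut => /=; rewrite !inE !negb_or.
move=> /and3P[/and3P[/eqP x01 /eqP x02 _] /andP[/eqP x12 _] _].
(* Among pairs with distinct coordinates, at most one lies in row [a] and at most one in column [b],
   so three are too many. *)
by case: (ab _ _ L1) (ab _ _ L2) (ab _ _ L3) => [?|?] [?|?] [?|?]; congruence.
Qed.
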